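(* Let $m\ge2$, $k\ge1$, $g\ge0$, $n=m+g(m-1)$, and let $D,D'$ be $(m-1)$-Dyck paths of length $n-1$. Then $D$ and $D'$ are $k$-equivalent if and only if $d(D)\equiv d(D')\pmod{k(m-1)}$ componentwise.
   Context: $N$ denotes the unit step $(1,1)$, $S$ the step $(1,-1)$; lattice paths are identified with words in $N,S$. An $(m-1)$-Dyck path is a lattice path from $(0,0)$ with up-steps $(m-1,m-1)$ and down-steps $(1,-1)$, never below the $x$-axis and ending on it; its length is its number of down-steps. Each $(m-1)$-Dyck path $D$ of length $n-1$ is uniquely written $N^{d_1}SN^{d_2}S\dots SN^{d_{n-1}}SN^{d_n}$ with $d_i$ non-negative multiples of $m-1$ and $d_n=0$; $d(D):=(d_1,\dots,d_n)$. Right $k$-compression: replace a consecutive subword $X=N^{m-1}D_1SD_2S\dots D_{j-1}SN^{k(m-1)}D_jSD_{j+1}S\dots SD_{m+k(m-1)}$ ($1\le j\le m-1$, each $D_i$ a possibly empty word that is an $(m-1)$-Dyck path up to translation) by $X'=N^{m-1}D_1S\dots D_{j-1}SD_jSN^{k(m-1)}D_{j+1}S\dots SD_{m+k(m-1)}$; left $k$-compression is the inverse. Two paths are $k$-equivalent if one is obtained from the other by a finite sequence of right and left $k$-compressions. *)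

(* Defs.v *)
From mathcomp Require Import all_boot all_order all_algebra.
From Stdlib Require Import Relations.

Set Implicit Arguments.
Unset Strict Implicit.
Unset Printing Implicit Defensive.

Import Order.TTheory GRing.Theory Num.Theory.

(* N is the unit step (1,1), S the step (1,-1). *)
Definition word := seq bool.
Notation stepN := true (only parsing).
Notation stepS := false (only parsing).

Definition height (w : word) : int :=
  ((count_mem stepN w)%:Z - (count_mem stepS w)%:Z)%R.

(* In u, true is an up-step (p,p), i.e. N^p, and false a down-step. *)
Definition steps_word (p : nat) (u : seq bool) : word :=
  flatten [seq if b then nseq p stepN else [:: stepS] | b <- u].

Definition dyck_path (p : nat) (w : word) : Prop :=
  [/\ exists u : seq bool, w = steps_word p u,
      forall i : nat, (0 <= height (take i w))%R
    & height w = 0%R].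

Definition dyck_length (w : word) : nat := count_mem stepS w.

(* (d_1, ..., d_n) such that w = N^{d_1} S N^{d_2} S ... S N^{d_n}; see
   [dseqK] and [runs_wordK]. *)
Fixpoint dseq (w : word) : seq nat :=
  match w with
  | [::] => [:: 0]
  | true :: w' => (head 0 (dseq w')).+1 :: behead (dseq w')
  | false :: w' => 0 :: dseq w'
  end.

Fixpoint runs_word (ds : seq nat) : word :=
  match ds with
  | [::] => [::]
  | [:: d] => nseq d stepN
  | d :: ds' => nseq d stepN ++ stepS :: runs_word ds'
  end.

Lemma size_dseq w : size (dseq w) = (dyck_length w).+1.
Proof.
rewrite /dyck_length; elim: w => [|[] w IH] //=; last by rewrite IH.
by rewrite size_behead IH.
Qed.

Lemma dseqK w : runs_word (dseq w) = w.
Proof.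
elim: w => [|b w IH] //; have := size_dseq w.
case: b => /=; case E: (dseq w) IH => [|d ds] //= <- _ //.
by case: ds {E}.
Qed.

Lemma runs_wordK ds : ds != [::] -> dseq (runs_word ds) = ds.
Proof.
elim: ds => [|d [|e ds] IH] // _; first by elim: d => [|d /= ->].
have {}IH := IH isT; rewrite [runs_word _]/=.
by elim: d => [|d /= ->] //; rewrite [LHS]/= IH.
Qed.

(* N^p D_1 S ... D_{j-1} S N^q D_j S D_{j+1} S ... S D_r *)
Definition compression_word (p q r j : nat) (D : nat -> word) : word :=
  nseq p stepN ++ flatten [seq rcons (D i) stepS | i <- index_iota 1 j]
  ++ nseq q stepN ++ flatten [seq rcons (D i) stepS | i <- index_iota j r]
  ++ D r.

(* The context words A and B are arbitrary: a compression, right or left,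
   of an (m-1)-Dyck path is again an (m-1)-Dyck path. *)
Definition right_compression (m k : nat) (P P' : word) : Prop :=
  let r := m + k * (m - 1) in
  exists (j : nat) (D : nat -> word) (A B : word),
    [/\ 1 <= j <= m - 1,
        forall i, 1 <= i <= r -> dyck_path (m - 1) (D i),
        P = A ++ compression_word (m - 1) (k * (m - 1)) r j D ++ B
      & P' = A ++ compression_word (m - 1) (k * (m - 1)) r j.+1 D ++ B].

Definition left_compression (m k : nat) (P P' : word) : Prop :=
  right_compression m k P' P.

Definition k_equivalent (m k : nat) : word -> word -> Prop :=
  clos_refl_trans word
    (fun P P' => right_compression m k P P' \/ left_compression m k P P').

(* Main.v *)
(** Every left compression moves a block [N^(k(m-1))] to an earlier run, and
    such a block at the beginning of any run but the first one can be moved: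
    the [S] before it belongs to a factor [N^(m-1) D_1 S ... D_j S] with
    [1 <= j <= m-1], and what follows it descends far enough to supply the
    remaining factors.  Left compressions thus lead from any path to one with
    [d_i < k(m-1)] for all [i >= 2].  Compressions preserve [d] modulo
    [k(m-1)], and such a reduced path is determined by the residues of its
    [d_i], [i >= 2], since [d_1] is then given by the total number of
    up-steps. *)

Require Import Defs.
From mathcomp Require Import all_boot all_order all_algebra.
From mathcomp Require Import zify.
From Stdlib Require Import Relations.

Set Implicit Arguments.
Unset Strict Implicit.
Unset Printing Implicit Defensive.

Import Order.TTheory GRing.Theory Num.Theory.

(** * Heights along paths and Dyck paths as letter sequences *)

(* Height reached from height [c] along [u], whose letter [true] is an up-step
   by [p]; [None] as soon as the path goes below the axis. *)
Fixpoint run (p c : nat) (u : seq bool) : option nat :=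
  match u with
  | [::] => Some c
  | true :: u' => run p (c + p) u'
  | false :: u' => if c is c'.+1 then run p c' u' else None
  end.

Lemma run_cat p c u v : run p c (u ++ v) = obind (fun h => run p h v) (run p c u).
Proof. by elim: u c => [|[] u IH] [|c] //=. Qed.

Lemma run_shift p c h x u : run p c u = Some h -> run p (c + x) u = Some (h + x).
Proof.
elim: u c => [|[] u IH] c /=; first by case=> ->.
  by rewrite addnAC; apply: IH.
by case: c => // c; apply: IH.
Qed.

Lemma run_nseq p c k : run p c (nseq k true) = Some (c + k * p).
Proof. by elim: k c => [|k IH] c /=; rewrite ?addn0 // IH mulSn addnA. Qed.

Lemma run_split p c u v h :
  run p c (u ++ v) = Some h -> exists2 x, run p c u = Some x & run p x v = Some h.
Proof. by rewrite run_cat; case: (run p c u) => //= x; exists x. Qed.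

(** Raising the start raises the end by the same amount, so different starts cannot share an end. *)
Lemma run_inj p c d u h : run p c u = Some h -> run p d u = Some h -> c = d.
Proof.
case: (leqP c d) => [le_cd|/ltnW le_dc] Hc Hd.
  by have := run_shift (d - c) Hc; rewrite subnKC // Hd; case; lia.
by have := run_shift (c - d) Hd; rewrite subnKC // Hc; case; lia.
Qed.

Lemma steps_word_cat p u v : steps_word p (u ++ v) = steps_word p u ++ steps_word p v.
Proof. by rewrite /steps_word map_cat flatten_cat. Qed.

Lemma steps_word_cons p b u :
  steps_word p (b :: u) = (if b then nseq p true else [:: false]) ++ steps_word p u.
Proof. by []. Qed.

Lemma steps_word_nseq p k : steps_word p (nseq k true) = nseq (k * p) true.
Proof. by elim: k => // k IH; rewrite mulSn nseqD -IH. Qed.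

(** Cutting an up-step into unit steps only adds points above its start, so it creates no new
    crossing of the axis. *)
Lemma run_steps_word p c u : run 1 c (steps_word p u) = run p c u.
Proof.
elim: u c => [|b u IH] c //; rewrite steps_word_cons; case: b.
  by rewrite run_cat run_nseq /= muln1 IH.
by case: c => [|c] /=.
Qed.

Lemma height_cons b w : height (b :: w) = ((if b then 1 else -1) + height w)%R.
Proof. by rewrite /height /=; case: b => /=; lia. Qed.

Lemma run1P c w h :
  run 1 c w = Some h <->
  (forall i, 0 <= c%:Z + height (take i w))%R /\ (c%:Z + height w = h%:Z)%R.
Proof.
elim: w c => [|b w IH] c /=.
  rewrite /height /=; split=> [[<-]|[_ ?]]; last by congr Some; lia.
  by split=> [i|]; lia.
case: b.
  rewrite IH; split=> -[H1 H2]; split.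
  - by case=> [|i] /=; rewrite ?height_cons ?take0 /=; [rewrite /height /=|have := H1 i]; lia.
  - by move: H2; rewrite height_cons; lia.
  - by move=> i; have := H1 i.+1; rewrite /= height_cons; lia.
  - by move: H2; rewrite height_cons; lia.
case: c => [|c].
  split=> // -[H1 _]; have := H1 1; rewrite /= take0 /height /=; lia.
rewrite IH; split=> -[H1 H2]; split.
- by case=> [|i] /=; rewrite ?height_cons ?take0 /=; [rewrite /height /=|have := H1 i]; lia.
- by move: H2; rewrite height_cons; lia.
- by move=> i; have := H1 i.+1; rewrite /= height_cons; lia.
- by move: H2; rewrite height_cons; lia.
Qed.

(** This passes from words in $N,S$ to sequences [u] of whole steps, in which a block $N^{kp}$ is
    [k] letters. *)
Lemma dyck_pathP p w :
  dyck_path p w <-> exists2 u, w = steps_word p u & run p 0 u = Some 0.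
Proof.
split=> [[[u ->] H1 H2]|[u -> Hu]].
  by exists u => //; rewrite -run_steps_word; apply/run1P; split=> [i|]; rewrite add0r.
have /run1P[H1 H2] : run 1 0 (steps_word p u) = Some 0 by rewrite run_steps_word.
split; first by exists u.
- by move=> i; have := H1 i; rewrite add0r.
- by move: H2; rewrite add0r.
Qed.

(** * Descents into balanced factors *)

(* [descent [:: D_1; ...; D_j]] is [D_1 S ... D_j S]. *)
Definition descent (Ds : seq (seq bool)) : seq bool :=
  flatten [seq rcons E false | E <- Ds].

Lemma descent_cat Ds Es : descent (Ds ++ Es) = descent Ds ++ descent Es.
Proof. by rewrite /descent map_cat flatten_cat. Qed.

Lemma descent_rcons Ds E : descent (rcons Ds E) = descent Ds ++ rcons E false.
Proof. by rewrite -cats1 descent_cat /descent /= cats0. Qed.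

Notation balanced p := (fun E => run p 0 E == Some 0).

Lemma run_balanced p c E : balanced p E -> run p c E = Some c.
Proof. by move/eqP/(run_shift c); rewrite add0n. Qed.

Lemma run_descent p c Ds :
  all (balanced p) Ds -> run p (c + size Ds) (descent Ds) = Some c.
Proof.
elim: Ds => [|E Ds IH] /=; first by rewrite addn0.
case/andP=> HE HDs; rewrite /descent /= -/(descent Ds) -cats1 -catA run_cat.
by rewrite run_balanced //= addnS IH.
Qed.

(** Cut at the first down-step reaching level [c], which exists since [v] ends no higher; until then
    the path stays at level [c.+1] or above. *)
Lemma first_descent p a c v h :
  run p (a + c.+1) v = Some h -> h <= c ->
  exists E w, [/\ v = rcons E false ++ w, run p a E = Some 0 & run p c w = Some h].
Proof.
elim: v a => [|[] v IH] a /=.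
- by case=> <-; lia.
- rewrite addnAC => Hv le_hc; have [E [w [-> HE Hw]]] := IH _ Hv le_hc.
  by exists (true :: E), w.
- case: a => [|a]; first by exists [::], v.
  rewrite addSn => Hv le_hc; have [E [w [-> HE Hw]]] := IH _ Hv le_hc.
  by exists (false :: E), w.
Qed.

Lemma descend p t c v h :
  run p (c + t) v = Some h -> h <= c ->
  exists Es w, [/\ v = descent Es ++ w, size Es = t & all (balanced p) Es].
Proof.
elim: t v => [|t IH] v Hv le_hc; first by exists [::], v.
rewrite addnS -[_.+1]add0n in Hv.
have [E [w [-> HE Hw]]] := first_descent Hv (leq_trans le_hc (leq_addr _ _)).
have [Es [w' [-> sEs HEs]]] := IH _ Hw le_hc.
exists (E :: Es), w'; split=> //=; rewrite ?sEs ?HE ?eqxx //.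
by rewrite /descent /= catA.
Qed.

(* If the up-step [N^p] matching the penultimate [S] is already exhausted by
   it, then this up-step starts a balanced factor, which is absorbed in [D_j]
   of the decomposition of the word without that factor. *)
Lemma last_ascent p u h : 0 < p ->
  run p 0 (rcons u false) = Some h ->
  exists A Ds, [/\ rcons u false = A ++ true :: descent Ds,
                   0 < size Ds <= p & all (balanced p) Ds].
Proof.
move=> p_gt0; have [b] := ubnP (size u); elim: b u h => // b IH u h.
case/lastP: u => [|u [|]] //.
  move=> _ _; exists u, [:: [::]]; split=> //.
  by rewrite -!cats1 -catA.
rewrite size_rcons => lt_u; rewrite -cats1 => /run_split[x Hx Hxh].
have {Hxh} def_x : x = h.+1 by case: x Hx Hxh => //= x _ [->].
have [//|A [Ds [def_u /andP[Ds_gt0 le_Ds] HDs]]] := IH u x _ Hx.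
have [lt_Ds|ge_Ds] := ltnP (size Ds) p.
  exists A, (rcons Ds [::]); split; rewrite ?size_rcons ?all_rcons //=.
  by rewrite def_u descent_rcons -catA.
have sDs : size Ds = p by lia.
have HE : balanced p (true :: descent Ds).
  by apply/eqP; have := run_descent 0 HDs; rewrite sDs.
(* The removed factor is balanced, so the penultimate height [h.+1] is already the height after
   [A]. *)
have HA : run p 0 (rcons A false) = Some h.
  move: Hx; rewrite def_u => /run_split[y Hy].
  by rewrite run_balanced // def_x => -[def_y]; rewrite -cats1 run_cat Hy def_y.
have ltA : size A < b.
  by move: (congr1 size def_u); rewrite size_rcons size_cat /=; lia.
have [A' [Ds' [def_A sDs' HDs']]] := IH A h ltA HA.
case/lastP: Ds' def_A sDs' HDs' => // Ds' E.
rewrite descent_rcons -[rcons E _]cats1 -cat_cons !catA cats1 => /rcons_inj[def_A].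
rewrite size_rcons all_rcons => sDs' /andP[HE' HDs'].
exists A', (rcons Ds' (E ++ true :: descent Ds)).
rewrite size_rcons all_rcons HDs' andbT; split=> //.
  by rewrite def_u def_A descent_rcons -!cats1 -!catA.
by rewrite run_cat (eqP HE').
Qed.

(** * Inversions, the measure that left compressions lower *)

Fixpoint inversions (u : seq bool) : nat :=
  match u with
  | [::] => 0
  | true :: u' => inversions u'
  | false :: u' => count_mem true u' + inversions u'
  end.

Lemma inversions_cat u v :
  inversions (u ++ v) = inversions u + inversions v + count_mem false u * count_mem true v.
Proof. elim: u => [|[] u IH] /=; rewrite ?count_cat ?IH ?add0n ?addn0 //.
by rewrite mulnDl mul1n addnACA !addnA. Qed.

(** Each letter of the block loses one inversion per down-step of [rcons E false], and no inversion
    is created. *)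
Lemma inversions_swap A E X k : 0 < k ->
  inversions (A ++ nseq k true ++ rcons E false ++ X)
    < inversions (A ++ rcons E false ++ nseq k true ++ X).
Proof.
move=> k_gt0; rewrite -cats1 !inversions_cat !count_cat !count_nseq /=; nia.
Qed.

(** * Existence of left compressions *)

Lemma flatten_steps_word p Ds :
  flatten [seq rcons (steps_word p E) false | E <- Ds] = steps_word p (descent Ds).
Proof.
elim: Ds => // E Ds IH; rewrite /= IH -cats1 /descent /= -/(descent Ds).
by rewrite -cats1 !steps_word_cat.
Qed.

(** Factors are numbered from 1, whence [i.-1]. The last index falls outside the list, so the
    default [[::]] makes $D_r$ empty. *)
Lemma compression_word_descent p k Ds Es :
  compression_word p (k * p) (size Ds + size Es).+1 (size Ds).+1
    (fun i => steps_word p (nth [::] (Ds ++ Es) i.-1))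
  = steps_word p (true :: descent Ds ++ nseq k true ++ descent Es).
Proof.
rewrite /compression_word steps_word_cons !steps_word_cat steps_word_nseq.
rewrite [nth _ _ (_.+1).-1]nth_default ?size_cat //= cats0 -!flatten_steps_word.
congr (_ ++ (flatten _ ++ (_ ++ flatten _))).
- rewrite /index_iota subn1 /= -[1]/(1 + 0) iotaDl -map_comp.
  rewrite -[in RHS](mkseq_nth [::] Ds) /mkseq -map_comp.
  apply/eq_in_map => i; rewrite mem_iota /= add0n => lt_i.
  by rewrite nth_cat lt_i.
- rewrite /index_iota subSS addKn -[(size Ds).+1]addn0 iotaDl -map_comp.
  rewrite -[in RHS](mkseq_nth [::] Es) /mkseq -map_comp.
  apply/eq_in_map => i _ /=.
  by rewrite nth_cat ltnNge leq_addr /= addKn.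
Qed.

Lemma left_compression_step p k U V : 0 < p -> 0 < k ->
  run p 0 (U ++ false :: nseq k true ++ V) = Some 0 ->
  exists u', [/\ right_compression p.+1 k (steps_word p u')
                    (steps_word p (U ++ false :: nseq k true ++ V)),
    run p 0 u' = Some 0
  & inversions u' < inversions (U ++ false :: nseq k true ++ V)].
Proof.
move=> p_gt0 k_gt0; rewrite -cat_rcons => Hu.
have [h HU HV] := run_split Hu.
have [A [Ds [def_U /andP[Ds_gt0 le_Ds] HDs]]] := last_ascent p_gt0 HU.
rewrite def_U in HU *.
have [a HA HX] := run_split HU.
(* The descent after the up-step falls from [a + p] to [h], one level per factor. *)
have def_h : h + size Ds = a + p.
  by have := run_inj (run_descent h HDs) HX.
rewrite run_cat run_nseq /= in HV; have HV' := HV.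
(* The compressed factor must return to its starting height [a]; this fixes how many factors [V] has
   to supply. *)
have def_hk : h + k * p = a + (p + k * p - size Ds) by lia.
rewrite def_hk in HV.
have [Es [B [def_V sEs HEs]]] := descend HV (leq0n _).
case/lastP: Ds Ds_gt0 le_Ds HDs def_U def_h {HU HX HV def_hk} sEs => // Ds E _.
rewrite size_rcons all_rcons => lt_Ds /andP[HE HDs] def_U def_h sEs.
(* The block jumps back over the last factor [E] and its [S]; the original word is the right
   compression of this one at $D_j=E$. *)
exists (A ++ true :: descent Ds ++ nseq k true ++ rcons E false ++ V); split.
- have sr : p.+1 + k * p = (size Ds + size Es).+2 by lia.
  exists (size Ds).+1, (fun i => steps_word p (nth [::] (rcons Ds E ++ Es) i.-1)).
  exists (steps_word p A), (steps_word p B); rewrite subn1 /= sr; split=> //.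
  + move=> i _; apply/dyck_pathP; exists (nth [::] (rcons Ds E ++ Es) i.-1) => //.
    have [lt_i|ge_i] := ltnP i.-1 (size (rcons Ds E ++ Es)); last by rewrite nth_default.
    apply/eqP; apply: (allP (a := balanced p)) (mem_nth _ lt_i).
    by rewrite all_cat all_rcons HE HDs.
  + have := compression_word_descent p k Ds (E :: Es).
    rewrite -(cat_rcons E) /= addnS => ->.
    by rewrite -!steps_word_cat /= def_V /descent /= -?catA /= -?catA.
  + have := compression_word_descent p k (rcons Ds E) Es.
    rewrite size_rcons /= addSn => ->.
    by rewrite -!steps_word_cat def_V -?catA /= -?catA.
- rewrite run_cat HA /= -def_h addnS -addSn run_cat run_descent //= run_cat run_nseq /=.
  by rewrite -cats1 -catA run_cat run_balanced //= addSn.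
- have := inversions_swap (A ++ true :: descent Ds) E V k_gt0.
  by rewrite descent_rcons -?catA /= -?catA.
Qed.

(** * Invariance of the residues of $d$ *)

Lemma dseq_nseq q w :
  dseq (nseq q true ++ w) = (q + head 0 (dseq w)) :: behead (dseq w).
Proof.
elim: q => [|q /= ->] //; have := size_dseq w.
by rewrite /=; case: (dseq w).
Qed.

(** The inserted block joins a single run, whose length grows by [q]. *)
Lemma map_modn_dseq_insert q u v :
  [seq d %% q | d <- dseq (u ++ nseq q true ++ v)] = [seq d %% q | d <- dseq (u ++ v)].
Proof.
elim: u => [|[] u IH] /=; last by rewrite IH.
- by rewrite dseq_nseq; have := size_dseq v; case: (dseq v) => //= d s _; rewrite modnDl.
- move: IH (size_dseq (u ++ nseq q true ++ v)) (size_dseq (u ++ v)).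
  case: (dseq (u ++ _ ++ _)) => //= d s; case: (dseq _) => //= e t [Hde ->] _ _.
  by rewrite -addn1 -(addn1 e) -modnDml Hde modnDml.
Qed.

Lemma right_compression_dseq m k P P' : right_compression m k P P' ->
  [seq d %% (k * (m - 1)) | d <- dseq P] = [seq d %% (k * (m - 1)) | d <- dseq P'].
Proof.
case=> j [D [A [B [/andP[j_gt0 le_j] _ -> ->]]]]; set r := m + _.
have lt_jr : j < r by rewrite /r; lia.
(* Both words come from the same word by inserting the block. That word is written with an empty
   block, placed at position 1. *)
suff insertE i : 0 < i <= r ->
    [seq d %% (k * (m - 1)) | d <-
       dseq (A ++ compression_word (m - 1) (k * (m - 1)) r i D ++ B)]
    = [seq d %% (k * (m - 1)) | d <-
       dseq (A ++ compression_word (m - 1) 0 r 1 D ++ B)].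
  by rewrite !insertE //; lia.
case/andP=> i_gt0 le_ir.
pose F a b := flatten [seq rcons (D x) false | x <- index_iota a b].
have FE : F 1 i ++ F i r = F 1 r.
  rewrite /F -flatten_cat -map_cat /index_iota; congr (flatten (map _ _)).
  have -> : r - 1 = (i - 1) + (r - i) by lia.
  by rewrite iotaD; congr (_ ++ iota _ _); lia.
rewrite /compression_word -/(F 1 i) -/(F i r) -/(F 1 r) [X in flatten (map _ X)]/index_iota subnn /=.
have := map_modn_dseq_insert (k * (m - 1)) (A ++ nseq (m - 1) true ++ F 1 i) (F i r ++ D r ++ B).
by rewrite -FE -!catA.
Qed.

Lemma k_equivalent_dseq m k P P' : k_equivalent m k P P' ->
  [seq d %% (k * (m - 1)) | d <- dseq P] = [seq d %% (k * (m - 1)) | d <- dseq P'].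
Proof.
elim=> {P P'} [P P' [/right_compression_dseq|/right_compression_dseq]|//|P Q R _ -> _ ->] //.
Qed.

Lemma k_equivalent_sym m k P P' : k_equivalent m k P P' -> k_equivalent m k P' P.
Proof.
elim=> {P P'} [P P' [H|H]|P|P Q R _ HPQ _ HQR].
- by apply: rt_step; right.
- by apply: rt_step; left.
- exact: rt_refl.
- exact: rt_trans HQR HPQ.
Qed.

(** * Reduced paths and the equivalence *)

Lemma dseq_head_steps p k u : 0 < p -> k * p <= head 0 (dseq (steps_word p u)) ->
  exists V, u = nseq k true ++ V.
Proof.
move=> p_gt0; elim: k u => [|k IH] u; first by exists u.
case: u => [|b u]; first by rewrite /= leqn0 muln_eq0 (eqn0Ngt p) p_gt0.
rewrite steps_word_cons; case: b => /=; last by rewrite leqn0 muln_eq0 (eqn0Ngt p) p_gt0.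
by rewrite dseq_nseq mulSn leq_add2l => /IH[V ->]; exists V.
Qed.

Lemma long_run_or_reduced p k u : 0 < p ->
  (exists U V, u = U ++ false :: nseq k true ++ V)
  \/ all (fun d => d < k * p) (behead (dseq (steps_word p u))).
Proof.
move=> p_gt0; elim: u => [|b u IH]; first by right.
have [[U [V ->]]|Hu] := IH; first by left; exists (b :: U), V.
case: b; rewrite steps_word_cons; first by right; rewrite dseq_nseq.
have [lt_d|/(dseq_head_steps p_gt0)[V ->]] := ltnP (head 0 (dseq (steps_word p u))) (k * p).
  by right=> /=; case: (dseq _) lt_d Hu => //= d s -> ->.
by left; exists [::], V.
Qed.

(** Left compressions are repeated while a long run follows some [S]; this stops because
    [inversions] decreases. *)
Lemma reduction p k u : 0 < p -> 0 < k -> run p 0 u = Some 0 ->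
  exists v, [/\ k_equivalent p.+1 k (steps_word p u) (steps_word p v),
    run p 0 v = Some 0
  & all (fun d => d < k * p) (behead (dseq (steps_word p v)))].
Proof.
move=> p_gt0 k_gt0; have [b] := ubnP (inversions u); elim: b u => // b IH u lt_u Hu.
have [[U [V def_u]]|Hred] := @long_run_or_reduced p k u p_gt0; last first.
  by exists u; split=> //; apply: rt_refl.
rewrite def_u in Hu lt_u *.
have [u' [Hcomp Hu' lt_u']] := left_compression_step p_gt0 k_gt0 Hu.
have [|v [Hu'v Hv red]] := IH u' _ Hu'; first exact: leq_trans lt_u' _.
exists v; split=> //.
by apply: rt_trans Hu'v; apply: rt_step; right.
Qed.

Lemma sumn_dseq w : sumn (dseq w) = count_mem true w.
Proof.
elim: w => [|[] w IH] //=.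
by rewrite -IH; have := size_dseq w; case: (dseq w).
Qed.

Lemma reduced_unique q w w' : height w = 0%R -> height w' = 0%R ->
  all (fun d => d < q) (behead (dseq w)) -> all (fun d => d < q) (behead (dseq w')) ->
  [seq d %% q | d <- dseq w] = [seq d %% q | d <- dseq w'] -> w = w'.
Proof.
move=> Hw Hw' red red' E; rewrite -(dseqK w) -(dseqK w'); congr runs_word.
have sz : dyck_length w = dyck_length w'.
  by have := congr1 size E; rewrite !size_map !size_dseq => -[].
(* Height zero and equally many [S] force equally many [N]; cancelling the equal tails then gives
   equal first runs. *)
have : sumn (dseq w) = sumn (dseq w').
  by rewrite !sumn_dseq; move: Hw Hw' sz; rewrite /height /dyck_length; lia.
have modK s : all (fun d => d < q) s -> [seq d %% q | d <- s] = s.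
  by elim: s => //= d s IH /andP[/modn_small-> /IH->].
move: (size_dseq w) (size_dseq w') red red' E.
case: (dseq w) => //= d s; case: (dseq w') => //= e t _ _ /modK Hs /modK Ht [_].
by rewrite Hs Ht => -> /addIn->.
Qed.

Theorem theorem3p15 (m k g n : nat) (D D' : word)
  (hm : 2 <= m) (hk : 1 <= k) (hn : n = m + g * (m - 1))
  (hD : dyck_path (m - 1) D) (hDn : dyck_length D = n - 1)
  (hD' : dyck_path (m - 1) D') (hDn' : dyck_length D' = n - 1) :
  k_equivalent m k D D' <->
  (forall i : nat, i < n ->
     nth 0 (dseq D) i = nth 0 (dseq D') i %[mod k * (m - 1)]).
Proof.
have n_gt0 : 0 < n by lia.
have sD : size (dseq D) = n by rewrite size_dseq hDn; lia.
have sD' : size (dseq D') = n by rewrite size_dseq hDn'; lia.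
split=> [/k_equivalent_dseq E i lt_in|E].
  have := congr1 (fun s => nth 0 s i) E.
  by rewrite !(nth_map 0) ?sD ?sD'.
have {E} E : [seq d %% (k * (m - 1)) | d <- dseq D]
             = [seq d %% (k * (m - 1)) | d <- dseq D'].
  apply: (@eq_from_nth _ 0); first by rewrite !size_map sD sD'.
  by move=> i; rewrite size_map sD => lt_in; rewrite !(nth_map 0) ?sD ?sD' ?E.
case: m hm {hn} hD hD' E => // p; rewrite subn1 /= => p_gt0.
move=> /dyck_pathP[u def_D Hu] /dyck_pathP[u' def_D' Hu'] E.
have [v [uv Hv red]] := reduction p_gt0 hk Hu.
have [v' [uv' Hv' red']] := reduction p_gt0 hk Hu'.
rewrite -def_D -def_D' in uv uv'.
have heightv x : run p 0 x = Some 0 -> height (steps_word p x) = 0%R.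
  by move=> Hx; have [] : dyck_path p (steps_word p x) by apply/dyck_pathP; exists x.
(* Both reductions preserve residues, so the reduced paths inherit the congruence between [D] and
   [D']. *)
have Evv' : steps_word p v = steps_word p v'.
  apply: (reduced_unique (heightv _ Hv) (heightv _ Hv') red red').
  have := k_equivalent_dseq uv; have := k_equivalent_dseq uv'.
  by rewrite subn1 /= => <- <-.
apply: rt_trans uv _; rewrite Evv'; exact: k_equivalent_sym uv'.
Qed.
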